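(* Let $p$ be an odd prime, $n\ge 1$ an integer, and $L$ the finite field with $q=p^{2n}$ elements. Let $s$ be an invertible Niho exponent over $L$. Then $s$ is singular, i.e. there exists $a\in L^\times$ with $W_{L,s}(a)=0$.
   Context: For $x\in L$ let $\mu(x)=e^{2\pi i\,\mathrm{Tr}_{L/\mathbb{F}_p}(x)/p}$ be the canonical additive character of $L$, where $\mathrm{Tr}_{L/\mathbb{F}_p}$ is the absolute trace. For a positive integer $s$ and $a\in L$, the Weil sum is $W_{L,s}(a)=\sum_{x\in L}\mu(x^s-ax)$. The exponent $s$ is invertible over $L$ if $\gcd(s,p^{2n}-1)=1$. A Niho exponent over $L$ (of order $p^{2n}$) is an integer $s$ that is not congruent to a power of $p$ modulo $p^{2n}-1$ but satisfies $s\equiv p^j \pmod{p^n-1}$ for some integer $j\ge 0$. *)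

(* Defs.v *)
From mathcomp Require Import all_boot all_order all_algebra all_field.
From mathcomp Require Import reals trigo.
From mathcomp.real_closed Require Import complex.

Set Implicit Arguments.
Unset Strict Implicit.
Unset Printing Implicit Defensive.

Import GRing.Theory.
Local Open Scope ring_scope.

(* [pPrimeCharType pcharL] is L itself, seen as a field extension of 'F_p;
   the trace lies in the line spanned by 1, and its coordinate on 1 is the
   corresponding element of 'F_p. *)
Definition abs_trace (L : finFieldType) (p : nat) (pcharL : p \in [pchar L])
    (x : L) : 'F_p :=
  let Lp := pPrimeCharType pcharL in
  coord [tuple (1 : Lp)] ord0 (galTrace 1%AS {:Lp}%AS (x : Lp)).

Definition add_char (R : realType) (L : finFieldType) (p : nat)
    (pcharL : p \in [pchar L]) (x : L) : R[i] :=
  let t := 2 * pi * (val (abs_trace pcharL x))%:R / p%:R : R in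
  (cos t +i* sin t)%C.

Definition weil_sum (R : realType) (L : finFieldType) (p : nat)
    (pcharL : p \in [pchar L]) (s : nat) (a : L) : R[i] :=
  \sum_(x : L) add_char R pcharL (x ^+ s - a * x).

(* Both notions concern the field of order p ^ (2 * n). *)
Definition invertible_exponent (p n s : nat) : bool :=
  coprime s (p ^ (2 * n)).-1.

Definition niho_exponent (p n s : nat) : Prop :=
  (forall j : nat, s <> p ^ j %[mod (p ^ (2 * n)).-1]) /\
  (exists j : nat, s = p ^ j %[mod (p ^ n).-1]).

(* Main.v *)
(* A Niho exponent acts on the subfield K with Q = p ^ n elements as a power of
   the Frobenius. Averaging the Weil sum W(a) over dilations by K thus replaces
   each term by a character sum over K, equal to Q if the trace from L to K of
   x ^ s - (a x) ^ (p ^ j) vanishes and to 0 otherwise; hence W(a) = Q (m_a - 1)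
   with m_a a natural number. Invertibility of s gives W(0) = 0 and, s being odd,
   orthogonality gives sum_a W(a) ^ 2 = Q ^ 4. If W had no zero on L^*, then
   sum_(a != 0) ((m_a - 1) ^ 2 - 1) = Q ^ 2 - (Q ^ 2 - 1) = 1, although every
   term is 0 or at least 3. *)
Require Import Defs.
From mathcomp Require Import all_boot all_order all_algebra all_field.
From mathcomp Require Import zify ring lra.
From mathcomp Require Import reals trigo.
From mathcomp.real_closed Require Import complex.

Import Order.TTheory GRing.Theory Num.Theory.
Local Open Scope ring_scope.

(** * Power maps and polynomial roots in a finite field *)

Lemma expf_modn_card (L : finFieldType) (x : L) (m : nat) :
  x ^+ (m * #|L|.-1 + 1) = x.
Proof.
have Hx : x ^+ #|L|.-1.+1 = x by rewrite prednK ?expf_card // (cardD1 0).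
elim: m => [|m IH]; first by rewrite expr1.
by rewrite mulSn -addnA exprD IH -exprSr.
Qed.

(** Bezout gives [u] with [u * s] equal to 1 modulo [#|L|.-1]; the power map of exponent [u] is a
    left inverse. *)
Lemma expf_coprime_inj (L : finFieldType) (s : nat) :
  (0 < s)%N -> coprime s #|L|.-1 -> injective (fun x : L => x ^+ s).
Proof.
move=> s0 /eqP cop; case: (egcdnP #|L|.-1 s0) => u v; rewrite cop => E _.
by apply: (can_inj (g := fun x => x ^+ u)) => x; rewrite -exprM mulnC E expf_modn_card.
Qed.

Lemma card_root_le (L : finFieldType) (f : {poly L}) :
  f != 0 -> (#|[set x | root f x]| < size f)%N.
Proof.
move=> f0; rewrite cardE; apply: max_poly_roots => //; last exact: enum_uniq.
by apply/allP => x; rewrite mem_enum inE.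
Qed.

(** * Orthogonality and second moment for an additive character *)

Section Character.

Context {C : numFieldType} {L : finFieldType} (psi : L -> C).
Hypothesis psiD : {morph psi : x y / x + y >-> x * y}.
Hypothesis psi_neq1 : exists v, psi v != 1.
Hypothesis psi_neq0 : forall x, psi x != 0.

Lemma char0 : psi 0 = 1.
Proof. by apply: (mulfI (psi_neq0 0)); rewrite -psiD addr0 mulr1. Qed.

Lemma charB x y : psi (x - y) = psi x / psi y.
Proof. by apply: (mulIf (psi_neq0 y)); rewrite -psiD subrK divfK. Qed.

Lemma charMn x k : psi (x *+ k) = psi x ^+ k.
Proof. by elim: k => [|k IH]; rewrite ?mulr0n ?char0 // mulrS psiD IH exprS. Qed.

Lemma sum_char_mul (w : L) : \sum_x psi (x * w) = (#|L| * (w == 0))%:R.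
Proof.
have [->|w0] := eqVneq w 0.
  by rewrite (eq_bigr (fun=> 1)) => [|x _]; rewrite ?mulr0 ?char0 // sumr_const muln1.
rewrite muln0; have [v v1] := psi_neq1.
apply: (mulfI (x := psi v - 1)); first by rewrite subr_eq0.
(* Translating [x] by [v / w] multiplies the sum by [psi v], which is not 1. *)
rewrite mulr0 mulrBl mul1r {2}(reindex_inj (addIr (v / w))) /= mulr_sumr.
apply/eqP; rewrite subr_eq0; apply/eqP/eq_bigr => x _.
by rewrite mulrDl divfK // psiD mulrC.
Qed.

Lemma sum_char : \sum_x psi x = 0.
Proof.
under eq_bigr do rewrite -[X in psi X]mulr1.
by rewrite sum_char_mul oner_eq0 muln0.
Qed.

(** For [psi := add_char R pcharL] this is convertible to [weil_sum]. *)
Definition char_sum (s : nat) (a : L) : C := \sum_x psi (x ^+ s - a * x).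

Lemma char_sum0 (s : nat) :
  (0 < s)%N -> coprime s #|L|.-1 -> char_sum s 0 = 0.
Proof.
move=> s0 cop; rewrite -sum_char (reindex_inj (expf_coprime_inj _ _ s0 cop)).
by apply: eq_bigr => x _; rewrite mul0r subr0.
Qed.

(** Summing over [a] first leaves only [y = - x]; as [s] is odd, [x ^+ s + y ^+ s] then vanishes, so
    each [x] contributes [#|L|]. *)
Lemma sum_sqr_char_sum (s : nat) :
  odd s -> \sum_a char_sum s a ^+ 2 = #|L|%:R ^+ 2.
Proof.
move=> os.
have E a : char_sum s a ^+ 2 =
    \sum_x \sum_y psi (x ^+ s + y ^+ s) * psi (a * - (x + y)).
  rewrite expr2 {1}/char_sum mulr_suml; apply: eq_bigr => x _.
  rewrite mulr_sumr; apply: eq_bigr => y _.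
  by rewrite -!psiD; congr psi; ring.
under eq_bigr do rewrite E.
rewrite exchange_big /= expr2 {1}mulr_natl -sumr_const.
apply: eq_bigr => x _; rewrite exchange_big (bigD1 (- x)) //=.
rewrite [X in _ + X]big1 ?addr0 => [|y yx]; rewrite -mulr_sumr sum_char_mul oppr_eq0.
  by rewrite subrr eqxx muln1 exprNn -signr_odd os mulN1r subrr char0 mul1r.
by rewrite [x + y]addrC addr_eq0 (negPf yx) muln0 mulr0.
Qed.

End Character.

(** * The subfield K with [Q] elements and the trace onto it *)

Section Niho.

Context {C : numFieldType} {L : finFieldType} (psi : L -> C) (p n : nat).
Hypothesis psiD : {morph psi : x y / x + y >-> x * y}.
Hypothesis psi_neq1 : exists v, psi v != 1.
Hypothesis psi_neq0 : forall x, psi x != 0.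
Hypothesis pcharL : p \in [pchar L].
Hypothesis psiX : forall x, psi (x ^+ p) = psi x.
Hypothesis p_odd : odd p.
Hypothesis n_gt0 : (0 < n)%N.
Hypothesis cardL : #|L| = (p ^ (2 * n))%N.

Local Notation Q := (p ^ n)%N.
(** K is handled as the fixed points of the [Q]-power Frobenius inside L, not as a type. *)
Local Notation in_sub y := (y ^+ Q == y).

(** The relative trace from L to K, an extension of degree 2. *)
Definition trQ (w : L) : L := w + w ^+ Q.

Lemma cardL_sqr : #|L| = (Q * Q)%N.
Proof. by rewrite cardL mul2n -addnn expnD. Qed.

Lemma p_prime : prime p. Proof. exact: pcharf_prime pcharL. Qed.

Lemma Q_gt2 : (2 < Q)%N.
Proof.
have p2 : (2 < p)%N by have := prime_gt1 p_prime; move: p_odd; case: (p) => [|[|[|]]].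
by apply: (leq_trans p2); rewrite -{1}[p]expn1 leq_exp2l ?prime_gt1 ?p_prime.
Qed.

Lemma psi_expr_pexp x k : psi (x ^+ (p ^ k)) = psi x.
Proof. by elim: k => [|k IH]; rewrite ?expr1 // expnSr exprM psiX. Qed.

Lemma exprD_pexp k (x y : L) : (x + y) ^+ (p ^ k) = x ^+ (p ^ k) + y ^+ (p ^ k).
Proof.
apply: exprDn_pchar; rewrite pnatX; apply/orP; left.
by rewrite (eq_pnat _ (pcharf_eq pcharL)) pnat_id // p_prime.
Qed.

Lemma exprB_pexp k (x y : L) : (x - y) ^+ (p ^ k) = x ^+ (p ^ k) - y ^+ (p ^ k).
Proof. by apply: (addIr (y ^+ (p ^ k))); rewrite -exprD_pexp !subrK. Qed.

Lemma expr_pexp_inj k : injective (fun x : L => x ^+ (p ^ k)).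
Proof.
move=> x y /eqP; rewrite -subr_eq0 -exprB_pexp expf_eq0 => /andP[_].
by rewrite subr_eq0 => /eqP.
Qed.

Lemma exprQQ (x : L) : (x ^+ Q) ^+ Q = x.
Proof. by rewrite -exprM -cardL_sqr expf_card. Qed.

(** Frobenius invariance of [psi] turns one of the two factors into [psi (y * w ^+ Q)]. *)
Lemma psi_sub_sqr y w : in_sub y -> psi (y * w) ^+ 2 = psi (y * trQ w).
Proof.
move=> /eqP yK; rewrite expr2 -{2}(psi_expr_pexp _ n) exprMn yK.
by rewrite -psiD -mulrDr.
Qed.

(** The values of [psi] are [p]-th roots of unity and [p] is odd. *)
Lemma psi_sqr_eq1 x : psi x ^+ 2 = 1 -> psi x = 1.
Proof.
move=> x2; have xp : psi x ^+ p = 1.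
  by rewrite -charMn // -mulr_natl (pcharf0 pcharL) mul0r char0.
by rewrite -xp -(odd_double_half p) p_odd -mul2n exprD exprM x2 expr1n mulr1.
Qed.

Lemma trQ_sub w : in_sub (trQ w).
Proof. by rewrite /trQ /= exprD_pexp exprQQ addrC. Qed.

(* For [y] in the subfield [psi (y * w) ^+ 2 = psi (y * trQ w)], and the values
   of [psi] have odd order. *)
Lemma sum_char_sub (w : L) :
  \sum_(y : L | in_sub y) psi (y * w) = (#|[set y : L | in_sub y]| * (trQ w == 0))%:R.
Proof.
have [w0|w0] := eqVneq (trQ w) 0.
  rewrite muln1 -sumr_const; apply: eq_big => [y|y yK]; first by rewrite inE.
  by apply: psi_sqr_eq1; rewrite psi_sub_sqr // w0 mulr0 char0.
rewrite muln0; have [y yK y1] : exists2 y : L, in_sub y & psi (y * w) != 1.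
  (* With this [y] in K, [psi (y * w) ^+ 2 = psi (trQ v) = psi v ^+ 2], so [psi (y * w) = 1] would
     force [psi v = 1]. *)
  have [v v1] := psi_neq1; exists (trQ v / trQ w).
    by rewrite exprMn exprVn !(eqP (trQ_sub _)).
  apply: contraNneq v1 => y1; apply/eqP/psi_sqr_eq1.
  rewrite -[v]mul1r psi_sub_sqr ?expr1n // mul1r -(divfK w0 (trQ v)).
  by rewrite -psi_sub_sqr ?y1 ?expr1n // exprMn exprVn !(eqP (trQ_sub _)).
apply: (mulfI (x := psi (y * w) - 1)); first by rewrite subr_eq0.
rewrite mulr0 mulrBl mul1r {2}(reindex_inj (addIr y)) /= mulr_sumr.
apply/eqP; rewrite subr_eq0; apply/eqP/eq_big => x.
  by rewrite exprD_pexp (eqP yK) (inj_eq (addIr y)).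
by rewrite mulrDl psiD mulrC.
Qed.

(** Used at [c = 1], where the set is K, and at [c = -1], where it is the kernel of [trQ]. *)
Lemma card_expr_root_le (c : L) : (#|[set x : L | (x ^+ Q == c * x)%R]| <= Q)%N.
Proof.
have sz : size ('X^Q - c *: 'X) = Q.+1.
  rewrite size_polyDl size_polyXn // size_polyN (leq_ltn_trans (size_scale_leq _ _)) //.
  by rewrite size_polyX ltnS (ltn_trans _ Q_gt2).
rewrite -ltnS -sz; apply: leq_ltn_trans (card_root_le _ _ _).
  apply/eq_leq/eq_card => x; rewrite !inE /root !hornerE.
  by rewrite subr_eq0.
by rewrite -size_poly_eq0 sz.
Qed.

(* Summing [sum_char_sub] over all [w] gives [#|K| * #|ker trQ| = #|L| = Q ^ 2],
   and both factors are at most [Q]. *)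
Lemma card_sub : #|[set y : L | in_sub y]| = Q.
Proof.
have : (#|[set y : L | in_sub y]| * #|[set w | trQ w == 0%R]|)%N = (Q * Q)%N.
  apply/eqP; rewrite -cardL_sqr -(eqr_nat C); apply/eqP.
  transitivity (\sum_w \sum_(y : L | in_sub y) psi (y * w)).
    under eq_bigr do rewrite sum_char_sub natrM.
    rewrite -mulr_sumr natrM; congr (_ * _).
    by rewrite -natr_sum -sum1dep_card big_mkcond.
  (* Summed over [w] first, only [y = 0] survives, by orthogonality on L. *)
  rewrite exchange_big (bigD1 0) /=; last by rewrite expr0n gtn_eqF ?(ltn_trans _ Q_gt2).
  rewrite [X in X + _](eq_bigr (fun=> 1)) => [|x _]; last by rewrite mul0r char0.
  rewrite sumr_const big1 ?addr0 // => y /andP[_ y0].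
  under eq_bigr do rewrite mulrC.
  by rewrite sum_char_mul // (negPf y0) muln0.
have := card_expr_root_le 1; have := card_expr_root_le (-1); have := Q_gt2.
have -> : [set x : L | x ^+ Q == 1 * x] = [set y : L | in_sub y].
  by apply/setP => x; rewrite !inE mul1r.
have -> : [set x : L | x ^+ Q == -1 * x] = [set w | trQ w == 0].
  by apply/setP => x; rewrite !inE /trQ mulN1r addrC addr_eq0.
move: #|[set y : L | in_sub y]| #|[set w | trQ w == 0]| => a b.
by move: (p ^ n)%N => c; nia.
Qed.

Lemma card_sub_unit : #|[set y : L | (y != 0) && in_sub y]| = Q.-1.
Proof.
rewrite -[in RHS]card_sub (cardD1 0 [set y : L | in_sub y]) !inE expr0n.
rewrite gtn_eqF ?(ltn_trans _ Q_gt2) //= eqxx add1n /=.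
by apply: eq_card => y; rewrite !inE.
Qed.

(* [x ^+ Q.-1] separates the cosets of the units of the subfield. *)
Lemma dvdn_card_sub_stable (A : {set L}) :
  0 \notin A -> (forall x y : L, x \in A -> y != 0 -> in_sub y -> y * x \in A) ->
  (Q.-1 %| #|A|)%N.
Proof.
move=> A0 Astab; rewrite -sum1_card (partition_big (fun x => x ^+ Q.-1) predT) //=.
apply: dvdn_sum => u _; rewrite sum1dep_card.
have Qs : Q.-1.+1 = Q by rewrite prednK // (ltn_trans _ Q_gt2).
have [[x xA]|no] := altP (@set0Pn _ [set x in A | x ^+ Q.-1 == u]); last first.
  by move/negbNE/eqP: no => ->; rewrite cards0 dvdn0.
move: xA; rewrite inE => /andP[xA /eqP <-].
have x0 : x != 0 by apply: contraNneq A0 => <-.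
suff -> : [set z in A | z ^+ Q.-1 == x ^+ Q.-1] =
          [set y * x | y in [set y : L | (y != 0) && in_sub y]].
  by rewrite card_imset ?card_sub_unit //; apply: mulIf.
apply/setP => z; rewrite inE; apply/andP/imsetP.
  move=> [zA /eqP E]; have z0 : z != 0 by apply: contraNneq A0 => <-.
  exists (z / x); last by rewrite divfK.
  rewrite inE mulf_neq0 ?invr_eq0 //= -{1}Qs exprS exprMn exprVn E.
  by rewrite divff ?mulr1 // expf_neq0.
move=> [y]; rewrite inE => /andP[y0 yK] ->; split; first exact: Astab.
suff -> : (y * x) ^+ Q.-1 = x ^+ Q.-1 by [].
rewrite exprMn; suff -> : y ^+ Q.-1 = 1 by rewrite mul1r.
by apply: (mulfI y0); rewrite -exprS Qs mulr1 (eqP yK).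
Qed.

(** * Weil sums of Niho exponents: multiples of [Q], and a zero *)

Section Integrality.

Context (s j : nat).
Hypothesis s_gt0 : (0 < s)%N.
Hypothesis niho : s = p ^ j %[mod (p ^ n).-1].

(** Units of K satisfy [y ^+ Q.-1 = 1]; positive exponents cover [y = 0]. *)
Lemma expr_sub_modn (y : L) (k l : nat) :
  in_sub y -> (0 < k)%N -> (0 < l)%N -> k = l %[mod Q.-1] -> y ^+ k = y ^+ l.
Proof.
move=> /eqP yK k0 l0 E; have [->|y0] := eqVneq y 0.
  by rewrite !expr0n !gtn_eqF.
have y1 : y ^+ Q.-1 = 1.
  by apply: (mulfI y0); rewrite -exprS prednK ?(ltn_trans _ Q_gt2) // mulr1.
by rewrite -(expr_mod k y1) E (expr_mod l y1).
Qed.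

Lemma pexp_gt0 : (0 < p ^ j)%N.
Proof. by rewrite expn_gt0 prime_gt0 ?p_prime. Qed.

(** This is [Q.-1] times the number m_a with W(a) = Q (m_a - 1). *)
Definition niho_card (a : L) : nat :=
  #|[set x | (x != 0) && (trQ (x ^+ s - (a * x) ^+ (p ^ j)) == 0)]|.

(** Scaling [x] by [y] in K multiplies the argument of [trQ] by [y ^+ (p ^ j)], which lies in K and
    factors out of the trace. *)
Lemma dvdn_niho_card a : (Q.-1 %| niho_card a)%N.
Proof.
apply: dvdn_card_sub_stable => [|x y]; first by rewrite inE eqxx.
rewrite !inE => /andP[x0 /eqP tx] y0 yK; rewrite mulf_neq0 //=.
suff -> : trQ ((y * x) ^+ s - (a * (y * x)) ^+ (p ^ j)) =
          y ^+ (p ^ j) * trQ (x ^+ s - (a * x) ^+ (p ^ j)) by rewrite tx mulr0.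
have -> : (y * x) ^+ s - (a * (y * x)) ^+ (p ^ j) =
          y ^+ (p ^ j) * (x ^+ s - (a * x) ^+ (p ^ j)).
  rewrite exprMn (@expr_sub_modn y s (p ^ j)) ?pexp_gt0 //.
  by rewrite [a * _]mulrCA [(y * (a * x)) ^+ _]exprMn mulrBr.
by rewrite /trQ [(y ^+ _ * _) ^+ _]exprMn exprAC (eqP yK) -mulrDr.
Qed.

(* Averaging [x -> y * x] over [y] in the subfield, where [y ^+ s = y ^+ (p ^ j)]
   and [psi] is Frobenius invariant. *)
Lemma char_sum_niho a :
  Q.-1%:R * (char_sum psi s a - 1) + #|L|.-1%:R = (Q * niho_card a)%:R.
Proof.
have pj0 := pexp_gt0.
pose F x := psi (x ^+ s - a * x).
have W1 : char_sum psi s a - 1 = \sum_(x | x != 0) F x.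
  rewrite /char_sum (bigD1 0) //= mulr0 subr0 expr0n gtn_eqF // char0 //.
  by rewrite addrC addrK.
have Fy x y : in_sub y ->
    F (y * x) = psi (y ^+ (p ^ j) * (x ^+ s - (a * x) ^+ (p ^ j))).
  move=> yK; rewrite /F charB // -(psi_expr_pexp (a * _) j) -charB //.
  by rewrite !exprMn (@expr_sub_modn y s (p ^ j)) // mulrBr mulrCA !mulrA.
(* Here [y = 0] contributes [#|L|.-1], and each of the [Q.-1] units of K contributes
   [char_sum psi s a - 1]. *)
transitivity (\sum_(y : L | in_sub y) \sum_(x | x != 0) F (y * x)).
  rewrite (bigD1 0) /=; last by rewrite expr0n gtn_eqF ?(ltn_trans _ Q_gt2).
  rewrite addrC; congr (_ + _); last first.
    rewrite (eq_bigr (fun=> 1)) => [|x _].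
      rewrite sumr_const; congr (_ *+ _); rewrite [in LHS](cardD1 0) add1n /=.
      by apply: eq_card => x; rewrite !inE andbT.
    by rewrite mul0r /F expr0n gtn_eqF // mulr0 subr0 char0.
  rewrite (eq_bigr (fun=> char_sum psi s a - 1)) => [|y /andP[_ y0]].
    rewrite sumr_const -card_sub_unit mulr_natl; congr (_ *+ _).
    by apply: eq_card => y; rewrite !inE andbC.
  rewrite W1 [RHS](reindex_inj (mulfI y0)) /=.
  by apply: eq_bigl => x; rewrite mulf_eq0 (negPf y0).
rewrite exchange_big /=.
transitivity (\sum_(x | x != 0) (Q * (trQ (x ^+ s - (a * x) ^+ (p ^ j)) == 0))%:R : C).
  apply: eq_bigr => x _; rewrite -[in RHS]card_sub -sum_char_sub.
  (* The map [y -> y ^+ (p ^ j)] permutes K. *)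
  rewrite [RHS](reindex_inj (expr_pexp_inj j)) /=.
  apply: eq_big => [y|y yK]; last exact: Fy.
  by rewrite exprAC (inj_eq (expr_pexp_inj j)).
rewrite -natr_sum -big_distrr /=; congr (_ * _)%:R.
by rewrite /niho_card -sum1dep_card [RHS]big_mkcondr.
Qed.

(** Since [#|L|.-1 = Q.-1 * Q.+1], [Q.-1] cancels from [char_sum_niho]. *)
Lemma char_sum_niho_integral a :
  char_sum psi s a = Q%:R * ((niho_card a %/ Q.-1)%:R - 1).
Proof.
have Qs : Q.-1.+1 = Q by rewrite prednK // (ltn_trans _ Q_gt2).
have Q1 : Q.-1%:R != 0 :> C by rewrite pnatr_eq0; have := Q_gt2; lia.
have := char_sum_niho a; rewrite -{1}(divnK (dvdn_niho_card a)).
have -> : #|L|.-1 = (Q.-1 * Q.+1)%N.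
  by rewrite cardL_sqr -[in LHS]Qs -[in RHS]Qs; lia.
rewrite !natrM -[Q.+1%:R]natr1 => E; apply: (mulfI Q1).
by apply: (addIr (Q.-1%:R * (Q%:R + 1))); rewrite -[char_sum _ _ _](subrK 1)
  mulrDr addrAC E -Qs -natr1; ring.
Qed.

(* [(m - 1) ^ 2 - 1] is written [m * (m - 2)] in [nat]: truncated subtraction
   still gives the right value [0] at [m = 0], and [m = 1] is excluded. *)
Lemma niho_singular : odd s -> coprime s #|L|.-1 ->
  exists2 a, a != 0 & char_sum psi s a = 0.
Proof.
move=> os cop; have [/exists_inP[a a0 /eqP W0]|/exists_inPn W] :=
  boolP [exists (a | a != 0), char_sum psi s a == 0]; first by exists a.
pose m a := (niho_card a %/ Q.-1)%N.
have m1 a : a != 0 -> m a != 1%N.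
  move=> /W; apply: contra => /eqP ma.
  by rewrite char_sum_niho_integral -/(m a) ma subrr mulr0.
have Q0 : Q%:R != 0 :> C by rewrite pnatr_eq0; have := Q_gt2; lia.
have E a : a != 0 -> char_sum psi s a ^+ 2 = Q%:R ^+ 2 * ((m a * (m a - 2))%:R + 1).
  move=> /m1; rewrite char_sum_niho_integral -/(m a) exprMn.
  case: (m a) => [|[|k]] //= _; first by rewrite mul0n sub0r sqrrN expr1n add0r.
  by rewrite subn2 /= natrM -!natr1; ring.
have S1 : (\sum_(a : L | a != 0%R) m a * (m a - 2) = 1)%N.
  apply/eqP; rewrite -(eqr_nat C); apply/eqP.
  have := sum_sqr_char_sum psi psiD psi_neq1 psi_neq0 s os.
  rewrite (bigD1 0) //= char_sum0 // expr0n add0r.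
  under eq_bigr => a a0 do rewrite E //.
  rewrite -mulr_sumr big_split /= -natr_sum.
  have -> : #|L|%:R ^+ 2 = Q%:R ^+ 2 * Q%:R ^+ 2 :> C.
    by rewrite cardL_sqr natrM -exprMn expr2.
  move/(mulfI (expf_neq0 2 Q0)); rewrite sumr_const.
  have -> : #|[pred a : L | a != 0]| = (Q * Q).-1.
    rewrite -cardL_sqr [in RHS](cardD1 0) add1n /=.
    by apply: eq_card => x; rewrite !inE andbT.
  have QQ : ((Q * Q).-1%:R + 1 : C) = Q%:R ^+ 2.
    by rewrite natr1 prednK ?muln_gt0 ?expn_gt0 ?prime_gt0 ?p_prime // natrM.
  by rewrite -QQ addrC => /addrI.
(* One [m a] above 2 already makes the sum at least 3; otherwise every [m a] is 0 or 2 and the sum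
   is 0. *)
have [/exists_inP[a a0 ma]|/exists_inPn ma] := boolP [exists (a | a != 0), (2 < m a)%N].
  by move: S1; rewrite (bigD1 a) //=; nia.
move: S1; rewrite big1 // => a a0; have := m1 a a0; have := ma a a0; nia.
Qed.

End Integrality.

End Niho.

(** * The absolute trace *)

Section AbsTrace.

Context {L : finFieldType} {p : nat} (pcharL : p \in [pchar L]).

Local Notation Lp := (pPrimeCharType pcharL).
Local Notation Tr := (abs_trace pcharL).

Lemma abs_traceD (x y : L) : Tr (x + y) = Tr x + Tr y.
Proof. by rewrite /abs_trace !raddfD. Qed.

Lemma galTrace_abs_trace (x : Lp) : galTrace 1%AS {:Lp}%AS x = Tr x *: 1.
Proof.
have /coord_span : galTrace 1%AS {:Lp}%AS x \in <<[tuple (1%R : Lp)]>>%VS.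
  by rewrite span_seq1; apply: (@mem_galTrace _ Lp 1%AS); rewrite ?memvf // finField_galois // subvf.
by rewrite big_ord1.
Qed.

(** Galois automorphisms commute with the Frobenius, which fixes the trace since it lies in the
    prime field. *)
Lemma abs_traceX (x : L) : Tr (x ^+ p) = Tr x.
Proof.
have pp : prime p := pcharf_prime pcharL.
have : galTrace 1%AS {:Lp}%AS ((x : Lp) ^+ p) = galTrace 1%AS {:Lp}%AS (x : Lp) ^+ p.
  rewrite -!(pFrobenius_autE pcharL) /galTrace rmorph_sum.
  by apply: eq_bigr => g _; rewrite /= !pFrobenius_autE rmorphXn.
rewrite !galTrace_abs_trace exprZn expr1n.
move/eqP; rewrite -subr_eq0 -scalerBl scaler_eq0 oner_eq0 orbF subr_eq0 => /eqP ->.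
by have := expf_card (Tr x); rewrite card_Fp.
Qed.

(** Dedekind independence: the sum of all Galois automorphisms is not the zero map. *)
Lemma abs_trace_neq0 : exists x : L, Tr x != 0.
Proof.
have [|//|x _ x0] := @gal_independent_contra _ Lp {:Lp}%AS [in ('Gal({:Lp} / 1%AS))%g] (fun=> 1) 1%g.
- by rewrite unfold_in; apply: fingroup.group1.
- exact: oner_neq0.
exists x; apply: contraNneq x0 => t0.
rewrite (eq_bigr (fun g : gal_of {:Lp} => g x)) => [|g _]; last by rewrite mul1r.
by have := galTrace_abs_trace x; rewrite t0 scale0r /galTrace => ->.
Qed.

End AbsTrace.

(** * The canonical additive character *)

Section AddChar.

Context {R : realType} {L : finFieldType} {p : nat} (pcharL : p \in [pchar L]).

(** The number exp(2 pi i k / p), for any natural [k], so that sums of exponents need no reduction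
    modulo [p]. *)
Definition root_of_unity (k : nat) : R[i] :=
  let t := 2 * pi * k%:R / p%:R : R in (cos t +i* sin t)%C.

Lemma natr_pchar_gt0 : 0 < p%:R :> R.
Proof. by rewrite ltr0n prime_gt0 // (pcharf_prime pcharL). Qed.

Lemma root_of_unityD k l :
  root_of_unity (k + l) = root_of_unity k * root_of_unity l.
Proof.
rewrite /root_of_unity natrD mulrDr mulrDl cosD sinD.
by apply/eqP; rewrite eq_complex /= eqxx /= addrC [X in X + _]mulrC [sin _ * cos _]mulrC.
Qed.

Lemma root_of_unityX k : root_of_unity k = root_of_unity 1 ^+ k.
Proof.
elim: k => [|k IH]; last by rewrite -add1n root_of_unityD IH exprS.
by rewrite /root_of_unity mulr0 mul0r cos0 sin0.
Qed.

Lemma root_of_unity_mod k : root_of_unity (k %% p) = root_of_unity k.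
Proof.
have e1 : root_of_unity 1 ^+ p = 1.
  rewrite -root_of_unityX /root_of_unity mulfK ?gt_eqF ?natr_pchar_gt0 //.
  by rewrite mulr_natl cos2pi sin2pi.
by rewrite root_of_unityX expr_mod // -root_of_unityX.
Qed.

Lemma root_of_unity_neq1 k : (0 < k < p)%N -> root_of_unity k != 1.
Proof.
move=> /andP[k0 kp]; rewrite eq_complex /= negb_and; apply/orP; left.
(* The half angle lies strictly between 0 and [pi], so the real part [1 - 2 * sin t ^+ 2] is below
   1. *)
pose t : R := pi * k%:R / p%:R.
have -> : 2 * pi * k%:R / p%:R = t *+ 2 by rewrite /t -[RHS]mulr_natl; ring.
have st : 0 < sin t.
  apply: sin_gt0_pi; rewrite divr_gt0 ?mulr_gt0 ?pi_gt0 ?ltr0n ?natr_pchar_gt0 //=.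
    by rewrite ltr_pdivrMr ?natr_pchar_gt0 // ltr_pM2l ?pi_gt0 // ltr_nat.
  by rewrite (leq_trans k0) // ltnW.
rewrite cos_mulr2n; have := cos2Dsin2 t; nra.
Qed.

Lemma add_charE x : add_char R pcharL x = root_of_unity (val (abs_trace pcharL x)).
Proof. by []. Qed.

Lemma add_charD : {morph add_char R pcharL : x y / x + y >-> x * y}.
Proof.
move=> x y; rewrite !add_charE abs_traceD -root_of_unityD -[RHS]root_of_unity_mod.
set u := abs_trace pcharL x; set v := abs_trace pcharL y.
rewrite -{1}[u]natr_Zp -{1}[v]natr_Zp -natrD; congr root_of_unity.
exact: val_Fp_nat (pcharf_prime pcharL) _.
Qed.

Lemma add_charX x : add_char R pcharL (x ^+ p) = add_char R pcharL x.
Proof. by rewrite !add_charE abs_traceX. Qed.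

Lemma add_char_neq1 : exists x, add_char R pcharL x != 1.
Proof.
have [x tx] := abs_trace_neq0 pcharL; exists x; apply: root_of_unity_neq1.
rewrite lt0n -[X in (_ < X)%N](Fp_cast (pcharf_prime pcharL)) ltn_ord andbT.
by apply: contra tx => /eqP t0; apply/eqP/val_inj.
Qed.

Lemma add_char_neq0 x : add_char R pcharL x != 0.
Proof.
rewrite add_charE eq_complex /=; apply/negP => /andP[/eqP c0 /eqP s0].
have := cos2Dsin2 (2 * pi * (val (abs_trace pcharL x))%:R / p%:R : R).
by rewrite c0 s0 !expr0n addr0 => /eqP; rewrite eq_sym oner_eq0.
Qed.

End AddChar.

Theorem theorem1p6 (R : realType) (p n : nat) (L : finFieldType)
  (pcharL : p \in [pchar L]) (s : nat) :
  prime p -> odd p -> (0 < n)%N -> #|L| = (p ^ (2 * n))%N ->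
  (0 < s)%N -> invertible_exponent p n s -> niho_exponent p n s ->
  exists a : L, a != 0 /\ weil_sum R pcharL s a = 0.
Proof.
move=> p_pr p_odd n_gt0 cardL s_gt0; rewrite /invertible_exponent -cardL => cop [_ [j sj]].
(* [s] is coprime to [#|L|.-1], which is even because [p] is odd. *)
have s_odd : odd s.
  rewrite -coprimen2; apply: coprime_dvdr cop.
  by rewrite dvdn2 cardL -oddS prednK ?expn_gt0 ?prime_gt0 // oddX p_odd orbT.
have [a a0 Wa] := niho_singular (add_char R pcharL) p n (add_charD pcharL) (add_char_neq1 pcharL)
  (add_char_neq0 pcharL) pcharL (add_charX pcharL) p_odd n_gt0 cardL _ _ s_gt0 sj s_odd cop.
by exists a.
Qed.
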